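(* Let $p\in\mathbb{N}$ be fixed. For $T$ Baire/measurable and $(z_n)$ a sequence of reals with $z_n\to0$, for generically all $t\in T$ there exists an infinite set $\mathbb{M}_t$ of natural numbers such that $$\{t+\bar z_{pm} : m\in\mathbb{M}_t\}\subseteq T .$$ Hence, if $Z\subseteq X$ accumulates at $0$ (has an accumulation point there), then for some $t\in T$ the set $Z\cap(T-t)$ accumulates at $0$ (along $Z$). Such a $t$ may be found in any open set with which $T$ has non-null intersection.
   Context: $T$ is a set of reals which either has the Baire property (the category case) or is Lebesgue measurable (the measure case). $X$ denotes the real line with either the Euclidean topology (category case) or the density topology (measure case); in the density topology the open sets are the measurable sets each of whose points is a Lebesgue density point of the set. ''For generically all $t\in T$'' means for all $t\in T$ except for those in a meagre set (category case) or a Lebesgue-null set (measure case). The notation $t+\bar z_{pm}$ abbreviates the block of $p$ consecutive shifted terms $t+z_{pm+1},\,t+z_{pm+2},\dots,\,t+z_{pm+p}$, so that $\{t+\bar z_{pm}:m\in\mathbb{M}_t\}=\{t+z_{pm+1},\dots,t+z_{pm+p}:m\in\mathbb{M}_t\}$. $T-t:=\{s-t:s\in T\}$. A set accumulates at $0$ if $0$ is an accumulation point of it, in the usual sense that some sequence of non-zero points of the set converges to $0$.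
   Formalization: The claim ''for some t in T the set Z∩(T−t) accumulates at 0'' is proved for T non-null (non-meagre in the category case); as written it fails for null T, e.g. T={0} and Z={1/n}. *)

(* Defs.v *)
From HB Require Import structures.
From mathcomp Require Import all_boot all_order all_algebra.
From mathcomp Require Import all_classical all_reals all_analysis.
From mathcomp Require Import measurable_realfun.

Set Implicit Arguments.
Unset Strict Implicit.
Unset Printing Implicit Defensive.

Import Order.TTheory GRing.Theory Num.Theory.
Import numFieldNormedType.Exports.

Local Open Scope classical_set_scope.
Local Open Scope ring_scope.

Definition nowhere_dense (X : topologicalType) (A : set X) : Prop :=
  interior (closure A) = set0.

Definition meagre (X : topologicalType) (A : set X) : Prop :=
  exists2 F : nat -> set X,
    forall n, nowhere_dense (F n) & A = \bigcup_n F n.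

Definition Baire_property (X : topologicalType) (A : set X) : Prop :=
  exists U M : set X,
    [/\ open U, meagre M & A = U `+` M].

(* [measurable] on a realType is Borel measurability; Lebesgue-measurable sets
   are those of its completion (see [completed_caratheodory_measurable]). *)
Definition Lebesgue_measurable (R : realType) (A : set R) : Prop :=
  completed_algebra_gen (@lebesgue_measure R) A.

Definition Lebesgue_null (R : realType) (A : set R) : Prop :=
  (@lebesgue_measure R).-negligible A.

Definition density_point (R : realType) (A : set R) (x : R) : Prop :=
  (completed_lebesgue_measure (A `&` ball x r)
     * (completed_lebesgue_measure (ball x r))^-1)%E
    @[r --> 0^'+] --> 1%E.

Definition density_open (R : realType) (U : set R) : Prop :=
  Lebesgue_measurable U /\ forall x, U x -> density_point U x.

Inductive setting := category_case | measure_case.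

Definition regular_set (R : realType) (c : setting) (T : set R) : Prop :=
  match c with
  | category_case => Baire_property T
  | measure_case => Lebesgue_measurable T
  end.

Definition small_set (R : realType) (c : setting) (N : set R) : Prop :=
  match c with
  | category_case => meagre N
  | measure_case => Lebesgue_null N
  end.

Definition X_open (R : realType) (c : setting) (U : set R) : Prop :=
  match c with
  | category_case => open U
  | measure_case => density_open U
  end.

Definition generically_all (R : realType) (c : setting) (T : set R)
    (P : R -> Prop) : Prop :=
  exists2 N : set R, small_set c N & forall t, T t -> ~ N t -> P t.

(* {t + z_{pm+1}, ..., t + z_{pm+p} : m in M} *)
Definition shifted_blocks (R : realType) (p : nat) (z : nat -> R) (t : R)
    (M : set nat) : set R :=
  [set t + z (p * m + i)%N | m in M & i in [set i : nat | (1 <= i <= p)%N]].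

Definition translate_back (R : realType) (T : set R) (t : R) : set R :=
  [set s - t | s in T].

(* Main.v *)
Require Import Defs.
From HB Require Import structures.
From mathcomp Require Import all_boot all_order all_algebra.
From mathcomp Require Import all_classical all_reals all_analysis.
From mathcomp Require Import measurable_realfun.
Import Order.TTheory GRing.Theory Num.Theory.
Import numFieldNormedType.Exports.
Local Open Scope classical_set_scope.
Local Open Scope ring_scope.

(** Everything reduces to one recurrence principle: for [z n --> 0], generically
all [t] in a regular set [T] are such that the blocks
[t + z (p * m + 1), ..., t + z (p * m + p)] lie inside [T] for arbitrarily
large [m].  Points that fail are shown to form a small set; both cases rest on
the fact that an open set containing [t] contains all late blocks
([eventually_block_in_open]), and on the translation invariance of smallness.

Category: write [T] as an open set [U] modified by a meagre set [M].  Off [M]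
and its countably many translates by the [z n], a point [t] of [T] lies in [U],
so its late blocks lie in [U] and avoid [M]: they lie in [T].

Measure: up to a null set, [T] is a countable union of Borel sets [D] of finite
measure.  Enclose [D] in an open [U] with [U \ D] of measure less than [e].  If
[t] is in [D] and none of its blocks of rank [m >= k] lies in [D], then, since
late blocks lie in [U], every late block meets [U \ D]; so [t] belongs to the limit
inferior of sets [E m], each a union of [p] translates of [U \ D] and hence of
measure at most [p * e].  By continuity from below the limit inferior has
measure at most [p * e] too, and [e] is arbitrary ([nonrecurrent_from_null]).
Only the lower limit of the [E m] is controlled, their measures being bounded
and not summable; hence infinitely many blocks, rather than all late ones.

For the last two claims, take a sequence of nonzero points of [Z] tending to
[0] and use blocks of length one.  The exceptional set of [T] is small, so it
cannot cover a part of [T] that is not small; applied to [T] and to [T] met with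
the given open set, this yields the point [t]
([limit_point_translate_back]). *)

Set Implicit Arguments.
Unset Strict Implicit.
Unset Printing Implicit Defensive.

(** * Recurrent points and blocks of shifts *)

(** A form of the infinitude of the set of good ranks that passes to supersets
and exposes the ranks one at a time. *)
Definition block_recurrent (R : realType) (p : nat) (z : nat -> R) (T : set R)
    (t : R) : Prop :=
  forall k : nat, exists2 m : nat, (k <= m)%N &
    forall i : nat, (1 <= i <= p)%N -> T (t + z (p * m + i)%N).

Lemma block_recurrentS (R : realType) (p : nat) (z : nat -> R) (S T : set R)
    (t : R) :
  S `<=` T -> block_recurrent p z S t -> block_recurrent p z T t.
Proof. by move=> ST rS k; have [m km Sm] := rS k; exists m => // i /Sm/ST. Qed.

Lemma infinite_shifted_blocks (R : realType) (p : nat) (z : nat -> R)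
    (T : set R) (t : R) :
  block_recurrent p z T t ->
  exists2 M : set nat, infinite_set M & shifted_blocks p z t M `<=` T.
Proof.
move=> rec; exists [set m | forall i, (1 <= i <= p)%N -> T (t + z (p * m + i)%N)].
  move=> /finite_seqP[s sE]; have [m sm Tm] := rec (\max_(n <- s) n).+1.
  have /= ms : [set` s] m by rewrite -sE.
  by move: sm; rewrite ltnNge leq_bigmax_seq.
by move=> _ [m Mm [i ip <-]]; exact: Mm.
Qed.

(** A position [1 <= i <= p] exists only if [0 < p], and then [p * m + i] is at
least [m], so late blocks consist of late terms of [z]. *)
Lemma eventually_block_in_open (R : realType) (p : nat) (z : nat -> R)
    (U : set R) (t : R) :
  z @ \oo --> (0 : R) -> open U -> U t ->
  exists k : nat, forall m i : nat,
    (k <= m)%N -> (1 <= i <= p)%N -> U (t + z (p * m + i)%N).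
Proof.
move=> z0 oU Ut.
have tz : t + z n @[n --> \oo] --> t.
  by rewrite -[X in _ --> X]addr0; apply: cvgD => //; exact: cvg_cst.
have [k _ kU] : \forall n \near \oo, U (t + z n).
  by apply: tz; exact: open_nbhs_nbhs.
exists k => m i km /andP[i1 ip]; apply: kU => /=.
rewrite (leq_trans km)// (leq_trans _ (leq_addr _ _))//.
by rewrite leq_pmull// (leq_trans i1).
Qed.

(** * Meagre sets *)

(** A translation is a homeomorphism: continuity of the shift by [a] sends the
closure of the preimage into the preimage of the closure, and continuity of the
shift by [- a] carries the neighbourhood back. *)
Lemma nowhere_dense_shift (R : realType) (a : R) (A : set R) :
  nowhere_dense A -> nowhere_dense ((fun x => x + a) @^-1` A).
Proof.
rewrite /nowhere_dense => A0; rewrite -subset0 => x xA.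
suff xA' : nbhs (x + a) (closure A).
  by have : (closure A)^° (x + a) := xA'; rewrite A0.
have shift_cvg (b y : R) : u + b @[u --> y] --> y + b.
  by apply: cvgD; [exact: cvg_id|exact: cvg_cst].
have nA : nbhs x ((fun u => u + a) @^-1` closure A).
  apply: filterS xA => u uA B /shift_cvg /uA[v [Av Bv]].
  by exists (v + a).
have := shift_cvg (- a) (x + a); rewrite addrK => /(_ _ nA) sA.
have {}sA : \forall u \near x + a, closure A (u - a + a) by exact: sA.
by apply: filterS sA => u; rewrite subrK.
Qed.

Lemma meagreS (X : topologicalType) (A B : set X) :
  A `<=` B -> meagre B -> meagre A.
Proof.
move=> AB [F nF BF]; exists (fun n => A `&` F n).
  move=> n; have := nF n; rewrite /nowhere_dense -!subset0; apply: subset_trans.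
  by apply: interiorS; apply: closureS; exact: subIsetr.
by rewrite -setI_bigcupr -BF setIidl.
Qed.

(** The double family of nowhere dense pieces is reindexed by [nat] through the
pairing [pickle]; codes of no pair get the empty set. *)
Lemma meagre_bigcup (X : topologicalType) (A : nat -> set X) :
  (forall n, meagre (A n)) -> meagre (\bigcup_n A n).
Proof.
move=> mA.
have /choice[F FA] n : exists F : nat -> set X,
    (forall k, nowhere_dense (F k)) /\ A n = \bigcup_k F k.
  by have [F] := mA n; exists F.
pose G n := if unpickle n is Some (i, j) then F i j else set0.
exists G => [n|].
  rewrite /G; case: unpickle => [[i j]|]; first by have [] := FA i.
  by rewrite /nowhere_dense closure0 interior0.
rewrite eqEsubset; split=> x [n _].
  rewrite (FA n).2 => -[k _ Fx]; exists (pickle (n, k)) => //.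
  by rewrite /G pickleK.
rewrite /G; case: unpickle => [[i j] Fx|//].
by exists i => //; rewrite (FA i).2; exists j.
Qed.

Lemma meagre_shift (R : realType) (a : R) (A : set R) :
  meagre A -> meagre ((fun x => x + a) @^-1` A).
Proof.
move=> [F nF ->]; exists (fun n => (fun x => x + a) @^-1` F n).
  by move=> n; exact: nowhere_dense_shift.
by rewrite preimage_bigcup.
Qed.

(** Off the meagre part and its translates, every late block works, not merely
infinitely many of them. *)
Lemma Baire_property_recurrent (R : realType) (p : nat) (z : nat -> R)
    (T : set R) :
  z @ \oo --> (0 : R) -> Baire_property T ->
  generically_all category_case T (block_recurrent p z T).
Proof.
move=> z0 [U [M [oU mM ->]]].
exists (\bigcup_n if n is n'.+1 then (fun x => x + z n') @^-1` M else M).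
  by apply: meagre_bigcup => -[//|n]; exact: meagre_shift.
move=> t Tt nMt.
have nM : ~ M t by move=> Mt; apply: nMt; exists 0%N.
have nMz n : ~ M (t + z n) by move=> Mt; apply: nMt; exists n.+1.
have Ut : U t by case: Tt => -[].
have [k kU] := @eventually_block_in_open R p z U t z0 oU Ut.
move=> j; exists (maxn j k); first exact: leq_maxl.
by move=> i ip; left; split=> //; apply: kU => //; exact: leq_maxr.
Qed.

(** * Null sets *)

(** By uniqueness of the measure extending the length of half-open intervals,
which translations preserve. *)
Lemma lebesgue_measure_shift (R : realType) (a : R) (A : set R) :
  measurable A -> lebesgue_measure ((fun x => x + a) @^-1` A) = lebesgue_measure A.
Proof.
have ms : measurable_fun setT ((fun x => x + a) : R -> measurableTypeR R).
  exact: measurable_funD.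
move=> mA; apply/esym.
apply: (@lebesgue_measure_unique R (pushforward lebesgue_measure
  ((fun x => x + a) : measurableTypeR R -> measurableTypeR R))) => // _ [[u v]] _ <-.
rewrite /pushforward/=.
rewrite [X in _ = lebesgue_measure X](_ : _ = `]u - a, v - a]%classic); last first.
  by apply/seteqP; split=> x /=; rewrite !in_itv/= ltrBlDr lerBrDr.
rewrite !lebesgue_measure_itv/= !lte_fin ltrBlDr subrK.
by case: ifPn => // _; rewrite -!EFinB opprB addrA subrK.
Qed.

(** The complement in [D] of the points having a block inside [D] at some rank
[m >= k], written with countable operations so that it is visibly Borel.  Block
positions are [i.+1] with [i < p]. *)
Definition nonrecurrent_from (R : realType) (p : nat) (z : nat -> R)
    (D : set R) (k : nat) : set R :=
  D `&` \bigcap_(m in [set m | (k <= m)%N])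
    \bigcup_(i < p) ~` ((fun x => x + z (p * m + i.+1)%N) @^-1` D).

Lemma measurable_shift (R : realType) (a : R) (A : set R) :
  measurable A -> measurable ((fun x => x + a) @^-1` A).
Proof.
move=> mA; rewrite -[X in measurable X]setTI.
exact: (measurable_funD (@measurable_id _ _ setT) (@measurable_cst _ _ _ _ setT a)).
Qed.

(** Finiteness of the measure of [D] gives the open envelope [U]; the points at
stake eventually have all their blocks meeting the tiny set [U \ D]. *)
Lemma nonrecurrent_from_null (R : realType) (p : nat) (z : nat -> R)
    (D : set R) (k : nat) :
  z @ \oo --> (0 : R) -> measurable D -> (lebesgue_measure D < +oo)%E ->
  Lebesgue_null (nonrecurrent_from p z D k).
Proof.
move=> z0 mD Dfin.
have mB : measurable (nonrecurrent_from p z D k).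
  apply: measurableI => //; apply: bigcap_measurableType => // m _.
  apply: bigcup_measurable => i _; apply: measurableC.
  exact: measurable_shift.
apply/negligibleP => //; apply/eqP; rewrite -measure_le0.
apply/lee_addgt0Pr => e e0; rewrite add0e.
(* p translates of the gap between U and D must fit in e; p.+1 keeps the divisor positive *)
have e1 : 0 < e / p.+1%:R by rewrite divr_gt0.
have [U [oU DU UD]] := @lebesgue_regularity_outer R D _ mD Dfin e1.
have mU : measurable U by exact: open_measurable.
(* the points whose block of rank m meets the gap between U and D *)
pose E m := \bigcup_(i < p)
  ((fun x => x + z (p * m + i.+1)%N) @^-1` (U `\` D)).
have mE m : measurable (E m).
  by apply: bigcup_measurable => i _; apply: measurable_shift; exact: measurableD.
have Ee m : (lebesgue_measure (E m) <= e%:E)%E.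
  apply: (@le_trans _ _ (\sum_(i < p) lebesgue_measure
      ((fun x => (x + z (p * m + i.+1)%N)%R) @^-1` (U `\` D)))%E).
    rewrite /E bigcup_mkord.
    apply: (Boole_inequality lebesgue_measure (A := fun i =>
      (fun x => x + z (p * m + i.+1)%N) @^-1` (U `\` D))) => i _.
    by apply: measurable_shift; exact: measurableD.
  apply: (@le_trans _ _ (\sum_(i < p) (e / p.+1%:R)%:E)%E).
    apply: lee_sum => i _; rewrite lebesgue_measure_shift; last exact: measurableD.
    exact: ltW.
  rewrite sumEFin lee_fin sumr_const card_ord -[leLHS]mulr_natr mulrAC.
  by rewrite ler_pdivrMr// ler_pM2l// ler_nat.
pose F j := \bigcap_(m in [set m | (j <= m)%N]) E m.
have mF j : measurable (F j) by exact: bigcap_measurableType.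
have BF : nonrecurrent_from p z D k `<=` \bigcup_j F j.
  move=> t [Dt Bt].
  have [l lU] := @eventually_block_in_open R p z U t z0 oU (DU _ Dt).
  exists (maxn k l) => // m /=; rewrite geq_max => /andP[km lm].
  have := Bt m km => -[i /= ip Di].
  exists i => //; split=> //; exact: lU.
apply: (@le_trans _ _ (lebesgue_measure (\bigcup_j F j))).
  by apply: le_measure; rewrite ?inE//; exact: bigcupT_measurable.
have ndF : nondecreasing_seq F.
  move=> i j ij; apply/subsetPset => t Fit m jm.
  by apply: Fit; exact: leq_trans jm.
have Fcvg := @nondecreasing_cvg_mu _ _ R lebesgue_measure F mF
  (bigcupT_measurable F mF) ndF.
apply: (cvge_to_le Fcvg).
apply: nearW => j /=; apply: le_trans (Ee j).
apply: le_measure; [by rewrite inE; exact: mF|by rewrite inE; exact: mE|].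
by apply: bigcap_inf => /=.
Qed.

(** The Borel kernel of [T] is cut by the intervals [[-n, n]] into sets of finite
measure; recurrence within one of the pieces is recurrence within [T]. *)
Lemma Lebesgue_measurable_recurrent (R : realType) (p : nat) (z : nat -> R)
    (T : set R) :
  z @ \oo --> (0 : R) -> Lebesgue_measurable T ->
  generically_all measure_case T (block_recurrent p z T).
Proof.
move=> z0 [A mA [N nN <-]].
pose D n : set R := A `&` `[- n%:R, n%:R].
have mD n : measurable (D n) by exact: measurableI.
have Dfin n : (lebesgue_measure (D n) < +oo)%E.
  apply: (@le_lt_trans _ _ (lebesgue_measure (`[- n%:R, n%:R] : set R))).
    apply: le_measure; [by rewrite inE; exact: mD| |exact: subIsetr].
    by rewrite inE; exact: measurable_itv.
  by rewrite lebesgue_measure_itv/=; case: ifP => // _; rewrite -EFinB ltry.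
exists (N `|` \bigcup_n \bigcup_k nonrecurrent_from p z (D n) k).
  apply: negligibleU => //; apply: negligible_bigcup => n.
  by apply: negligible_bigcup => k; exact: nonrecurrent_from_null.
move=> t Tt /not_orP[nNt nBt].
have At : A t by case: Tt.
have [n tn] : exists n : nat, `|t| <= n%:R.
  by exists (Num.bound `|t|); rewrite ltW// archi_boundP.
have Dt : D n t by split=> //=; rewrite in_itv/= -ler_norml.
apply: (@block_recurrentS _ _ _ (D n)) => [x [Ax _]|k]; first by left.
have : ~ nonrecurrent_from p z (D n) k t.
  by move=> Bt; apply: nBt; exists n => //; exists k.
apply: contra_notP => nrec; split=> // m km.
apply: contra_notP nrec => nB; exists m => // -[//|i] ip.
by apply: contrapT => nD; apply: nB; exists i.
Qed.

(** * Both cases together *)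

Lemma regular_set_recurrent (R : realType) (c : setting) (p : nat)
    (z : nat -> R) (T : set R) :
  z @ \oo --> (0 : R) -> regular_set c T ->
  generically_all c T (block_recurrent p z T).
Proof.
case: c => z0.
- exact: Baire_property_recurrent.
- exact: Lebesgue_measurable_recurrent.
Qed.

Lemma small_setS (R : realType) (c : setting) (A B : set R) :
  A `<=` B -> small_set c B -> small_set c A.
Proof.
case: c; first exact: meagreS.
by move=> AB; apply: (@negligibleS _ _ _ lebesgue_measure).
Qed.

Lemma limit_point_recurrent (R : realType) (z : nat -> R) (Z T : set R) (t : R) :
  z @ \oo --> (0 : R) -> (forall n, Z (z n)) -> (forall n, z n != 0) ->
  block_recurrent 1 z T t -> limit_point (Z `&` translate_back T t) 0.
Proof.
move=> z0 Zz zn0 rec V /z0[k _ kV]; have [m km Tm] := rec k.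
exists (z (1 * m + 1)%N); split=> //.
  split=> //; exists (t + z (1 * m + 1)%N); first exact: Tm.
  by rewrite addrAC subrr add0r.
by apply: kV => /=; rewrite mul1n (leq_trans km)// leq_addr.
Qed.

(** The exceptional set of [T] is small, so it cannot contain [W]; the recurrence
of [t] takes place in [T], which serves every such part [W] of [T] at once. *)
Lemma limit_point_translate_back (R : realType) (c : setting)
    (Z T W : set R) :
  regular_set c T -> limit_point Z 0 -> W `<=` T -> ~ small_set c W ->
  exists2 t : R, W t & limit_point (Z `&` translate_back T t) 0.
Proof.
move=> regT /limit_pointP[z [zZ zn0 z0]] WT nW.
have [N sN NT] := @regular_set_recurrent R c 1 z T z0 regT.
have [t [Wt nNt]] : exists t, W t /\ ~ N t.
  apply: contra_notP nW => nWN; apply: small_setS sN => t Wt.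
  by apply: contrapT => nNt; apply: nWN; exists t.
exists t => //; apply: limit_point_recurrent z0 _ zn0 (NT _ (WT _ Wt) nNt).
by move=> n; apply: zZ; exists n.
Qed.

Unset Implicit Arguments.
Set Strict Implicit.

Theorem theorem5p3 (R : realType) (c : setting) (p : nat) (T : set R)
    (regT : regular_set c T) :
  (forall z : nat -> R, z @ \oo --> (0 : R) ->
     generically_all c T (fun t =>
       exists2 M : set nat, infinite_set M & shifted_blocks p z t M `<=` T))
  /\
  (forall Z : set R, limit_point Z 0 ->
     (~ small_set c T ->
        exists2 t : R, T t & limit_point (Z `&` translate_back T t) 0)
     /\
     (forall U : set R, X_open c U -> ~ small_set c (T `&` U) ->
        exists2 t : R, (T `&` U) t &
          limit_point (Z `&` translate_back T t) 0)).
Proof.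
split=> [z z0|Z Z0].
  have [N sN NT] := @regular_set_recurrent R c p z T z0 regT.
  by exists N => // t Tt /(NT _ Tt)/infinite_shifted_blocks.
split=> [nT|U _ nTU].
- exact: limit_point_translate_back nT.
- by apply: limit_point_translate_back nTU => //; exact: subIsetl.
Qed.
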